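(* Let $G$ be a finite group and $A$ a finite set of size $q \geq 2$. Let $[H_1], \dots, [H_r]$ be the list of different conjugacy classes of subgroups of $G$. For each $1 \leq i \leq r$, fix a $G$-orbit $O_i \subseteq B_{[H_i]}$. Then \[ \mathrm{ICA}(G;A) \cong \prod_{i=1}^r \left( C_i \wr \mathrm{Sym}_{\alpha_i} \right), \] where $C_i := C(G^{O_i}) \cong C_{\mathrm{Sym}(O_i)}(G^{O_i})$ and $\alpha_i := \alpha_{[H_i]}(G;A)$.
   Context: Functions are applied on the right and composed left to right. $A^G$ is the set of all functions $x : G \to A$. A cellular automaton over $G$ and $A$ is a map $\tau : A^G \to A^G$ for which there are a finite subset $S \subseteq G$ (a memory set) and a local function $\mu : A^S \to A$ with $(g)(x)\tau = ((R_g \circ x)|_S)\mu$ for all $x \in A^G$, $g \in G$, where $(h)R_g := hg$, so that $(h)(R_g\circ x) = (hg)x$. $\mathrm{CA}(G;A)$ is the monoid of all cellular automata over $G$ and $A$ under composition, and $\mathrm{ICA}(G;A)$ is its group of invertible elements (those $\tau\in\mathrm{CA}(G;A)$ with a two-sided inverse in $\mathrm{CA}(G;A)$). $G$ acts on $A^G$ by $(h)(x \cdot g) = (hg^{-1})x$ for $h\in G$. The $G$-orbit of $x$ is $xG := \{x \cdot g : g \in G\}$; the stabiliser is $G_x := \{g \in G : x \cdot g = x\}$. $[H]$ is the conjugacy class of a subgroup $H \leq G$. Define $B_{[H]} := \{x \in A^G : G_x \in [H]\}$ (a nonempty union of $G$-orbits) and let $\alpha_{[H]}(G;A)$ be the number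 of $G$-orbits contained in $B_{[H]}$. For a $G$-orbit $O$ on $A^G$, let $G_{(O)} := \bigcap_{x \in O} G_x$ and $G^O := G/G_{(O)}$, regarded as a subgroup of $\mathrm{Sym}(O)$ (the permutation group induced by $G$ on $O$). $C(G^O) := \{\tau|_O : \tau \in \mathrm{ICA}(G;A),\ (O)\tau = O\}$, a group under composition, and $C_{\mathrm{Sym}(O)}(G^O)$ is the centraliser of $G^O$ in $\mathrm{Sym}(O)$. $\mathrm{Sym}_\alpha$ is the symmetric group on $\alpha$ points. For a group $C$, the wreath product $C \wr \mathrm{Sym}_\alpha$ is the set of pairs $(v;\phi)$ with $v \in C^\alpha$, $\phi \in \mathrm{Sym}_\alpha$, with $(v;\phi)\cdot(w;\psi) = (v w^\phi; \phi\psi)$ and $w^\phi := (w_{(1)\phi}, \dots, w_{(\alpha)\phi})$; for $\alpha = 1$ this is just $C$. *)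

(* Defs.v *)
From HB Require Import structures.
From mathcomp Require Import all_boot all_fingroup.

Set Implicit Arguments.
Unset Strict Implicit.
Unset Printing Implicit Defensive.

Local Open Scope group_scope.

(* Functions act on the right and compose from left to right.  This is also   *)
(* the convention for {perm T}: (s * t) x = t (s x).                          *)

Section CellularAutomata.

Variables (gT : finGroupType) (A : finType).

Definition config := {ffun gT -> A}.

Implicit Types (x y : config) (g h : gT) (O : {set config}).

(* S is the memory set and mu : A^S -> A the local function, applied to the   *)
(* restriction to S of R_g \o x, i.e. to s |-> x (s * g).                     *)
Definition is_CA (tau : config -> config) : bool :=
  [exists S : {set gT}, exists mu : {ffun {ffun {s : gT | s \in S} -> A} -> A},
     forall x : config, forall g : gT,
     tau x g == mu [ffun s : {s : gT | s \in S} => x (val s * g)]].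

(* An invertible cellular automaton is a permutation of A^G, and its          *)
(* two-sided inverse is its inverse permutation.                              *)
Definition ICA : {set {perm config}} := [set s : {perm config} | is_CA s & is_CA s^-1].

Definition shift x g : config := [ffun h => x (h * g^-1)].

Lemma shift1 x : shift x 1 = x.
Proof. by apply/ffunP=> h; rewrite ffunE invg1 mulg1. Qed.

Lemma shiftM x : act_morph shift x.
Proof. by move=> g k; apply/ffunP=> h; rewrite !ffunE invMg mulgA. Qed.

Definition shift_action : {action gT &-> config} := TotalAction shift1 shiftM.

Lemma is_CAP (tau : config -> config) :
  reflect (forall x g, tau (shift x g) = shift (tau x) g) (is_CA tau).
Proof.
apply: (iffP existsP) => [[S /existsP[mu /forallP tauE]] x g | tau_shift].
  have tau_mu y k := eqP (forallP (tauE y) k).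
  apply/ffunP=> h; rewrite [RHS]ffunE !tau_mu; congr (mu _).
  by apply/ffunP=> s; rewrite !ffunE mulgA.
exists setT; apply/existsP.
exists [ffun p : {ffun {s : gT | s \in [set: gT]} -> A} =>
          tau [ffun h => p (exist _ h (in_setT h))] 1].
apply/forallP=> x; apply/forallP=> g; apply/eqP; rewrite ffunE.
have ->: tau x g = shift (tau x) g^-1 1 by rewrite ffunE invgK mul1g.
rewrite -tau_shift; congr (tau _ 1).
by apply/ffunP=> h; rewrite !ffunE invgK.
Qed.

Lemma group_set_ICA : group_set ICA.
Proof.
apply/group_setP; split=> [|s t].
  by rewrite inE invg1; apply/andP; split; apply/is_CAP=> x g; rewrite !perm1.
rewrite !inE => /andP[/is_CAP sC /is_CAP sVC] /andP[/is_CAP tC /is_CAP tVC].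
apply/andP; split; apply/is_CAP=> x g.
  by rewrite !permM sC tC.
by rewrite invMg !permM tVC sVC.
Qed.
Canonical ICA_group := Group group_set_ICA.

Definition orbits : {set {set config}} :=
  [set orbit shift_action [set: gT] x | x : config].

(* K :^: [set: gT] is the conjugacy class [K].                                *)
Definition box (K : {set gT}) : {set config} :=
  [set x | 'C[x | shift_action] \in K :^: [set: gT]].

Definition alpha (K : {set gT}) : nat :=
  #|[set O in orbits | O \subset box K]|.

(* Sym(O) is Sym O, the group of permutations of A^G with support in O, and   *)
(* restr_perm O maps a permutation stabilising O to the one induced on O.     *)

Definition induced_group O : {set {perm config}} :=
  [set restr_perm O (actperm shift_action g) | g in [set: gT]].

Definition restr_ICA O : {set {perm config}} :=
  [set restr_perm O tau | tau : {perm config} in ICA & tau @: O == O].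

Lemma mem_stab_perm O (s : {perm config}) :
  (s \in 'N(O | 'P)) = (s @: O == O).
Proof.
rewrite eqEcard (card_imset _ (@perm_inj _ s)) leqnn andbT.
apply/idP/subsetP => [sN _ /imsetP[x Ox ->] | sO].
  by have:= astabs_act x sN; rewrite /= apermE => ->.
by rewrite !inE; apply/subsetP=> x Ox; rewrite inE /= apermE sO ?imset_f.
Qed.

Lemma restr_ICAE O : restr_ICA O = restr_perm O @* 'N_ICA(O | 'P).
Proof.
rewrite morphimEsub ?subsetIr //; apply/setP=> p.
apply/imsetP/imsetP=> -[s]; rewrite inE => /andP[sC sN] ->; exists s => //.
  by rewrite in_setI mem_stab_perm sC.
by rewrite inE -mem_stab_perm sC.
Qed.

Lemma group_set_restr_ICA O : group_set (restr_ICA O).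
Proof. by rewrite restr_ICAE groupP. Qed.
Canonical restr_ICA_group O := Group (group_set_restr_ICA O).

Lemma orbit_stab O g : O \in orbits -> actperm shift_action g \in 'N(O | 'P).
Proof.
case/imsetP=> x _ ->; rewrite mem_stab_perm eqEcard.
rewrite (card_imset _ (@perm_inj _ _)) leqnn andbT.
apply/subsetP=> _ /imsetP[y /orbitP[h _ <-] ->].
by rewrite actpermE -actM mem_orbit ?inE.
Qed.

(* The intersection of the stabilisers of the points of O is                  *)
(* 'C(O | shift_action).                                                      *)
Lemma induced_group_isog O : O \in orbits ->
  [set: gT] / 'C(O | shift_action) \isog induced_group O.
Proof.
move=> Oorb; pose f g := restr_perm O (actperm shift_action g).
have fM : {in [set: gT] &, {morph f : g h / g * h}}.
  move=> g h _ _; rewrite /f (actpermM _ (in_setT g) (in_setT h)).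
  by apply: (morphM (restr_perm_morphism O)); exact: orbit_stab.
have fE g x : x \in O -> f g x = shift x g.
  by move=> Ox; rewrite /f restr_permE ?orbit_stab // actpermE.
pose fm := Morphism fM.
have ker_f : 'ker fm = 'C(O | shift_action).
  apply/setP=> g; apply/kerP/astabP => [||f_fix]; rewrite ?inE //.
    by move=> f1 x Ox; rewrite -[LHS]/(shift x g) -fE // [f g]f1 perm1.
  apply/permP=> x; rewrite perm1.
  have [Ox | nOx] := boolP (x \in O).
    by rewrite [LHS]fE //; exact: f_fix.
  exact: out_perm (restr_perm_on _ _) nOx.
have -> : induced_group O = fm @* [set: gT] by rewrite morphimEdom.
by rewrite -ker_f first_isog.
Qed.

End CellularAutomata.

Section WreathProduct.

Variables (gT : finGroupType) (n : nat).

Record wreath_type :=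
  Wreath { wreath_base : {ffun 'I_n -> gT}; wreath_top : {perm 'I_n} }.

Definition prod_of_wreath w := (wreath_base w, wreath_top w).
Definition wreath_of_prod p := Wreath p.1 p.2.

Lemma prod_of_wreathK : cancel prod_of_wreath wreath_of_prod.
Proof. by case. Qed.

HB.instance Definition _ :=
  Finite.copy wreath_type (can_type prod_of_wreathK).

Implicit Types u v w : wreath_type.

Definition wreath_mul v w : wreath_type :=
  Wreath [ffun i => wreath_base v i * wreath_base w (wreath_top v i)]
         (wreath_top v * wreath_top w).

Definition wreath_one : wreath_type := Wreath [ffun=> 1] 1.

Definition wreath_inv v : wreath_type :=
  Wreath [ffun i => (wreath_base v ((wreath_top v)^-1 i))^-1]
         (wreath_top v)^-1.

Lemma wreath_mulA : associative wreath_mul.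
Proof.
move=> u v w; congr Wreath; last exact: mulgA.
by apply/ffunP=> i; rewrite !ffunE permM mulgA.
Qed.

Lemma wreath_mul1 : left_id wreath_one wreath_mul.
Proof.
case=> v s; congr Wreath; last exact: mul1g.
by apply/ffunP=> i; rewrite !ffunE perm1 mul1g.
Qed.

Lemma wreath_mulV : left_inverse wreath_one wreath_inv wreath_mul.
Proof.
case=> v s; congr Wreath; last exact: mulVg.
by apply/ffunP=> i; rewrite !ffunE mulVg.
Qed.

HB.instance Definition _ := Finite_isGroup.Build wreath_type
  wreath_mulA wreath_mul1 wreath_mulV.

(* The wreath product of a subgroup C of gT with the symmetric group on n     *)
(* points.                                                                    *)
Definition wreath (C : {set gT}) : {set wreath_type} :=
  [set w | [forall i, wreath_base w i \in C]].

Lemma group_set_wreath (C : {group gT}) : group_set (wreath C).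
Proof.
apply/group_setP; split=> [|v w].
  by rewrite inE; apply/forallP=> i; rewrite ffunE.
rewrite !inE => /forallP Cv /forallP Cw.
by apply/forallP=> i; rewrite ffunE groupM.
Qed.
Canonical wreath_group (C : {group gT}) := Group (group_set_wreath C).

End WreathProduct.

Arguments ICA : clear implicits.
Arguments orbits : clear implicits.
Arguments wreath {gT} n C.

(* Main.v *)
(* The invertible cellular automata are the permutations of A^G commuting with
   the shift action, and those supported on one orbit O form the centraliser of
   G^O in Sym(O).  Orbits lying in the same box are exchanged by an involution
   of ICA(G;A), so that every orbit Q_k of B_[H_i] is the image of O_i under
   some c_k in ICA(G;A).  If tau in ICA(G;A) maps each Q_k to Q_(phi k), then the
   permutations v_k := c_k tau c_(phi k)^-1 stabilise O_i, and tau is sent to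
   the family over i of the elements (v; phi).  The boxes cover A^G, are pairwise
   disjoint and are preserved by ICA(G;A), so tau can be recovered from this
   family, and the family can be prescribed at will. *)

Require Import Defs.
From mathcomp Require Import all_boot all_fingroup.

Local Open Scope group_scope.

Set Implicit Arguments.
Unset Strict Implicit.
Unset Printing Implicit Defensive.

(** * Equivariance, orbits and boxes *)

Section InvertibleCA.

Variables (gT : finGroupType) (A : finType).

Implicit Types (x y z : config gT A) (g : gT) (O Q : {set config gT A}).
Implicit Types (K : {set gT}) (s t : {perm config gT A}).

Local Notation orb := (orbit (shift_action gT A) [set: gT]).

(** Equivariance passes from [s] to its inverse: apply the injective [s] to both sides and
    cancel. *)
Lemma ICAP s :
  reflect (forall x g, s (shift x g) = shift (s x) g) (s \in ICA gT A).
Proof.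
rewrite inE; apply: (iffP andP) => [[/is_CAP]//|sC].
split; apply/is_CAP=> // x g.
by apply: (@perm_inj _ s); rewrite sC !permKV.
Qed.

Lemma ICA_orbit s x : s \in ICA gT A -> s @: orb x = orb (s x).
Proof.
move/ICAP=> sC; apply/setP=> y; apply/imsetP/orbitP => [[_ /orbitP[g _ <-] ->]|].
  by exists g => //=; rewrite sC.
by case=> g _ <-; exists (shift x g); rewrite ?sC //; apply/orbitP; exists g.
Qed.

Lemma mem_orbits x : orb x \in orbits gT A.
Proof. exact: imset_f. Qed.

Lemma orbits_eq O x : O \in orbits gT A -> x \in O -> O = orb x.
Proof. by case/imsetP=> y _ -> /orbit_eqP. Qed.

Lemma orbits_shift O x g : O \in orbits gT A -> (shift x g \in O) = (x \in O).
Proof. by case/imsetP=> y _ ->; rewrite (orbit_actr (shift_action gT A)) ?inE. Qed.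

Lemma ICA_imset_orbits s O :
  s \in ICA gT A -> O \in orbits gT A -> s @: O \in orbits gT A.
Proof. by move=> sC /imsetP[x _ ->]; rewrite ICA_orbit ?mem_orbits. Qed.

(** Equivariance makes the stabiliser of [x] fix [s x]; injectivity of [s] gives the converse. Hence
    [ICA] preserves every box. *)
Lemma ICA_astab1 s x : s \in ICA gT A ->
  'C[s x | shift_action gT A] = 'C[x | shift_action gT A].
Proof.
move/ICAP=> sC; apply/setP=> g; apply/astab1P/astab1P => /= [|gx].
  by rewrite -sC => /perm_inj.
by rewrite -sC gx.
Qed.

Lemma ICA_box s x K : s \in ICA gT A -> (s x \in box A K) = (x \in box A K).
Proof. by move=> sC; rewrite !inE ICA_astab1. Qed.

Lemma box_shift x g K : (shift x g \in box A K) = (x \in box A K).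
Proof.
have box_sub u h : u \in box A K -> shift u h \in box A K.
  rewrite !inE (astab1_act (shift_action gT A)) => /imsetP[k _ ->].
  by rewrite -conjsgM imset_f.
by apply/idP/idP=> /box_sub; [move/(_ g^-1); rewrite -shiftM mulgV shift1 | apply].
Qed.

Definition box_orbits K : {set {set config gT A}} :=
  [set O in orbits gT A | O \subset box A K].

Lemma box_orbitsP K O x :
  O \in box_orbits K -> x \in O -> x \in box A K.
Proof. by rewrite inE => /andP[_ /subsetP]; apply. Qed.

Lemma orbit_box_orbits K x :
  x \in box A K -> orb x \in box_orbits K.
Proof.
move=> xK; rewrite inE mem_orbits; apply/subsetP=> _ /orbitP[g _ <-].
by rewrite /= box_shift.
Qed.

Lemma ICA_imset_box_orbits s K O :
  s \in ICA gT A -> O \in box_orbits K -> s @: O \in box_orbits K.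
Proof.
move=> sC; rewrite !inE => /andP[Oorb /subsetP OK].
rewrite ICA_imset_orbits //; apply/subsetP=> _ /imsetP[x /OK xK ->].
by rewrite ICA_box.
Qed.

(** * Restriction to a single orbit and the centraliser *)

Lemma restr_perm_ICA s O : O \in orbits gT A -> s \in ICA gT A ->
  s @: O = O -> restr_perm O s \in ICA gT A.
Proof.
move=> Oorb /ICAP sC sO; apply/ICAP=> x g.
have sN: s \in 'N(O | 'P) by rewrite mem_stab_perm sO.
(* [O] and its complement are both shift-invariant, so equivariance survives extension by the
   identity outside [O]. *)
have [Ox | nOx] := boolP (x \in O).
  by rewrite !restr_permE ?orbits_shift.
by rewrite !(out_perm (restr_perm_on _ _)) ?orbits_shift.
Qed.

Lemma restr_ICA_Sym O : O \in orbits gT A -> restr_ICA O = ICA gT A :&: Sym O.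
Proof.
move=> Oorb; apply/setP=> p; apply/imsetP/setIP => [[s] | [pC]].
  rewrite inE => /andP[sC /eqP sO] ->.
  by rewrite restr_perm_ICA // inE restr_perm_on.
rewrite inE => pO; have pOO := im_perm_on pO.
exists p; first by rewrite inE pC pOO /=.
have pN: p \in 'N(O | 'P) by rewrite mem_stab_perm pOO.
apply/permP=> x; have [Ox | nOx] := boolP (x \in O); first by rewrite restr_permE.
by rewrite (out_perm pO) // (out_perm (restr_perm_on _ _)).
Qed.

(** Members of [Sym O] and of [induced_group O] fix everything outside [O], so commutation is tested
    on [O] alone, where the induced permutations are the shifts. *)
Lemma restr_ICA_centraliser O : O \in orbits gT A ->
  restr_ICA O = 'C_(Sym O)(induced_group O).
Proof.
move=> Oorb; rewrite restr_ICA_Sym // setIC; apply/setP=> p.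
rewrite !in_setI inE; case pO: (perm_on O p) => //=.
have restrE g x : x \in O ->
  restr_perm O (actperm (shift_action gT A) g) x = shift x g.
  by move=> Ox; rewrite restr_permE ?orbit_stab // actpermE.
have pOE x : (p x \in O) = (x \in O) by rewrite perm_closed.
apply/ICAP/centP => [pC _ /imsetP[g _ ->] | pC x g].
  apply/permP=> x; rewrite !permM.
  have [Ox | nOx] := boolP (x \in O); first by rewrite !restrE ?pOE ?pC.
  by rewrite !(out_perm (restr_perm_on _ _)) ?pOE // (out_perm pO).
have [Ox | nOx] := boolP (x \in O); last by rewrite !(out_perm pO) ?orbits_shift.
have /permP/(_ x) : commute p (restr_perm O (actperm (shift_action gT A) g)).
  by apply: pC; apply: imset_f.
by rewrite !permM !restrE ?pOE.
Qed.

(** * Exchanging two orbits with equal stabilisers *)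

Section Exchange.

Variables x y : config gT A.
Hypothesis eq_stab :
  'C[x | shift_action gT A] = 'C[y | shift_action gT A].
Hypothesis disj_orb : y \notin orb x.

(** The result does not depend on the picked [g]: by [eq_stab], two elements that shift [x] alike
    also shift [y] alike, and conversely. *)
Definition exchange_fun z : config gT A :=
  if [pick g | shift x g == z] is Some g then shift y g else
  if [pick g | shift y g == z] is Some g then shift x g else z.

Let shift_eq g h : (shift x g == shift x h) = (shift y g == shift y h).
Proof.
have canE u : (shift u g == shift u h) = (g * h^-1 \in 'C[u | shift_action gT A]).
  rewrite (sameP astab1P eqP) /= shiftM.
  by rewrite -[LHS](inj_eq (act_inj (shift_action gT A) h^-1)) /= -!shiftM mulgV shift1.
by rewrite !canE eq_stab.
Qed.

Let shift_neq g h : (shift x g == shift y h) = false.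
Proof.
apply: contraNF disj_orb => /eqP eq_xy; apply/orbitP; exists (g * h^-1) => //=.
by rewrite shiftM eq_xy -shiftM mulgV shift1.
Qed.

Let exchangeL g : exchange_fun (shift x g) = shift y g.
Proof.
rewrite /exchange_fun; case: pickP => [h | /(_ g)]; last by rewrite eqxx.
by rewrite shift_eq => /eqP.
Qed.

Let exchangeR g : exchange_fun (shift y g) = shift x g.
Proof.
rewrite /exchange_fun; case: pickP => [h | _]; first by rewrite shift_neq.
by case: pickP => [h | /(_ g)]; rewrite ?eqxx // -shift_eq => /eqP.
Qed.

Let exchange_out z : z \notin orb x -> z \notin orb y -> exchange_fun z = z.
Proof.
move=> xz yz; rewrite /exchange_fun.
case: pickP => [g /eqP xg | _]; first by case/orbitP: xz; exists g.
by case: pickP => [g /eqP yg | //]; case/orbitP: yz; exists g.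
Qed.

Lemma exchange_ICA : exists2 s, s \in ICA gT A & s x = y.
Proof.
(* Case principle: a configuration is a shift of [x], a shift of [y], or outside both orbits. *)
have orbW (P : config gT A -> Prop) : (forall g, P (shift x g)) ->
    (forall g, P (shift y g)) ->
    (forall z, z \notin orb x -> z \notin orb y -> P z) -> forall z, P z.
  move=> Px Py Pz z; case xz: (z \in orb x).
    by case/orbitP: xz => g _ <-; apply: Px.
  case yz: (z \in orb y); first by case/orbitP: yz => g _ <-; apply: Py.
  by apply: Pz; rewrite ?xz ?yz.
have exchangeK : involutive exchange_fun.
  elim/orbW=> [g | g | z xz yz]; rewrite ?exchangeL ?exchangeR //.
  by rewrite !exchange_out.
exists (perm (inv_inj exchangeK)); last first.
  by rewrite permE -[x]shift1 exchangeL shift1.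
apply/ICAP=> z h; rewrite !permE.
elim/orbW: z => [g | g | z xz yz]; rewrite -?shiftM ?exchangeL ?exchangeR ?shiftM //.
by rewrite !exchange_out ?orbits_shift ?mem_orbits.
Qed.

End Exchange.

Lemma ICA_box_orbits_trans K O Q : O \in box_orbits K -> Q \in box_orbits K ->
  exists2 s, s \in ICA gT A & s @: O = Q.
Proof.
move=> OK QK; have [<- | neqOQ] := eqVneq O Q.
  by exists 1; rewrite ?group1 // (eq_imset (g := id)) ?imset_id // => x; rewrite perm1.
move: (OK) (QK); rewrite !inE => /andP[Oorb _] /andP[Qorb _].
have /imsetP[x _ defO] := Oorb; have /imsetP[y _ defQ] := Qorb.
have := box_orbitsP OK (x := x); rewrite defO orbit_refl inE => /(_ isT).
have := box_orbitsP QK (x := y); rewrite {1}defQ orbit_refl inE => /(_ isT).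
move=> /imsetP[h _ stab_y] /imsetP[g _ stab_x].
(* The stabilisers of [x] and [y] are [K :^ g] and [K :^ h]; shifting [y] by [h^-1 * g] turns the
   second into the first. *)
pose y' := shift y (h^-1 * g).
have Qy' : y' \in Q by rewrite defQ orbits_shift ?mem_orbits ?orbit_refl.
have eq_stab : 'C[x | shift_action gT A] = 'C[y' | shift_action gT A].
  by rewrite (astab1_act (shift_action gT A)) stab_x stab_y -conjsgM mulKVg.
have disj : y' \notin orb x.
  apply: contraNN neqOQ; rewrite -defO => Oy'.
  by rewrite (orbits_eq Oorb Oy') -(orbits_eq Qorb Qy').
have [s sC sxy] := exchange_ICA eq_stab disj.
by exists s; rewrite // ICA_orbit // sxy -(orbits_eq Qorb).
Qed.

(** * Wreath coordinates on one box *)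

Section Coordinates.

Variables (K : {set gT}) (O : {set config gT A}).
Hypothesis OK : O \in box_orbits K.

Let Oorb : O \in orbits gT A.
Proof. by move: OK; rewrite inE => /andP[]. Qed.

Local Notation n := (alpha A K).

(** [alpha A K] unfolds to the cardinal of [box_orbits K], so ['I_n] enumerates these orbits
    directly. *)
Definition box_orbit (k : 'I_n) : {set config gT A} := enum_val k.

Lemma box_orbit_in k : box_orbit k \in box_orbits K.
Proof. exact: enum_valP. Qed.

Lemma box_orbit_surj Q : Q \in box_orbits K -> exists k, Q = box_orbit k.
Proof.
by move=> QK; exists (enum_rank_in QK Q); rewrite /box_orbit enum_rankK_in.
Qed.

Lemma box_orbit_inj k l x : x \in box_orbit k -> x \in box_orbit l -> k = l.
Proof.
move=> xk xl; apply: enum_val_inj; rewrite -!/(box_orbit _).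
have:= box_orbit_in k; have:= box_orbit_in l.
rewrite !inE => /andP[lorb _] /andP[korb _].
by rewrite (orbits_eq lorb xl) (orbits_eq korb xk).
Qed.

(** The default 1 only makes the function total; for [s] in [ICA gT A] the pick succeeds. *)
Definition orbit_perm s : {perm 'I_n} :=
  odflt 1 [pick p : {perm 'I_n} | [forall k, box_orbit (p k) == s @: box_orbit k]].

Lemma orbit_permE s k :
  s \in ICA gT A -> box_orbit (orbit_perm s k) = s @: box_orbit k.
Proof.
move=> sC; rewrite /orbit_perm; case: pickP => [p /forallP/(_ k)/eqP // | noperm].
pose f j := enum_rank_in (box_orbit_in j) (s @: box_orbit j).
have fE j : box_orbit (f j) = s @: box_orbit j.
  by rewrite /box_orbit enum_rankK_in ?(ICA_imset_box_orbits sC (box_orbit_in j)).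
have f_inj : injective f.
  move=> i j /(congr1 box_orbit); rewrite !fE.
  by move/(imset_inj perm_inj)/enum_val_inj.
by case/negP: (negbT (noperm (perm f_inj))); apply/forallP=> j; rewrite permE fE.
Qed.

Definition transport (k : 'I_n) : {perm config gT A} :=
  odflt 1 [pick s in ICA gT A | s @: O == box_orbit k].

Lemma transportP k :
  transport k \in ICA gT A /\ transport k @: O = box_orbit k.
Proof.
rewrite /transport; case: pickP => [s /andP[sC /eqP] // | notr].
have [s sC sO] := ICA_box_orbits_trans OK (box_orbit_in k).
by have:= notr s; rewrite sC sO eqxx.
Qed.

Let transC k : transport k \in ICA gT A. Proof. by case: (transportP k). Qed.
Let transO k : transport k @: O = box_orbit k. Proof. by case: (transportP k). Qed.

Definition base_cocycle s k : {perm config gT A} :=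
  transport k * s * (transport (orbit_perm s k))^-1.

Lemma base_cocycle_ICA s k : s \in ICA gT A -> base_cocycle s k \in ICA gT A.
Proof. by move=> sC; rewrite !groupM ?groupV ?transC. Qed.

Lemma base_cocycle_stab s k : s \in ICA gT A -> base_cocycle s k @: O = O.
Proof.
move=> sC; apply/eqP; rewrite eqEcard (card_imset _ (@perm_inj _ _)) leqnn andbT.
apply/subsetP=> _ /imsetP[x Ox ->]; rewrite !permM.
have : s (transport k x) \in box_orbit (orbit_perm s k).
  by rewrite orbit_permE // -transO !imset_f.
by rewrite -transO => /imsetP[y Oy ->]; rewrite permK.
Qed.

(** [transport k] is $c_k$ and [base_cocycle s k] is $v_k$. Applying [restr_perm O] discards the
    action outside [O], so the entries lie in [restr_ICA O]. *)
Definition coordinates s : wreath_type {perm config gT A} n :=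
  Wreath [ffun k => restr_perm O (base_cocycle s k)] (orbit_perm s).

Lemma orbit_permM s t : s \in ICA gT A -> t \in ICA gT A ->
  orbit_perm (s * t) = orbit_perm s * orbit_perm t.
Proof.
move=> sC tC; apply/permP=> k; apply: enum_val_inj.
rewrite permM -!/(box_orbit _) !orbit_permE ?groupM // -imset_comp.
by apply: eq_imset => x; rewrite /= permM.
Qed.

(** The factors $c_{\phi k}^{-1} c_{\phi k}$ cancel in the middle, leaving the twisted product $v
    w^\phi$. *)
Lemma coordinatesM s t : s \in ICA gT A -> t \in ICA gT A ->
  coordinates (s * t) = coordinates s * coordinates t.
Proof.
move=> sC tC; congr Wreath; last exact: orbit_permM.
apply/ffunP=> k; rewrite !ffunE /= -morphM; first last.
- by rewrite mem_stab_perm base_cocycle_stab.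
- by rewrite mem_stab_perm base_cocycle_stab.
congr (restr_perm O _).
by rewrite /base_cocycle orbit_permM // permM !mulgA mulgKV.
Qed.

Lemma coordinates_wreath s :
  s \in ICA gT A -> coordinates s \in wreath n (restr_ICA O).
Proof.
move=> sC; rewrite inE; apply/forallP=> k; rewrite ffunE; apply: imset_f.
by rewrite inE base_cocycle_ICA ?base_cocycle_stab /=.
Qed.

Lemma coordinatesE s k x : s \in ICA gT A -> x \in O ->
  s (transport k x) = transport (wreath_top (coordinates s) k)
                        (wreath_base (coordinates s) k x).
Proof.
move=> sC Ox; rewrite ffunE restr_permE ?mem_stab_perm ?base_cocycle_stab //.
by rewrite !permM permKV.
Qed.

Lemma restr_ICA_closed p x : p \in restr_ICA O -> (p x \in O) = (x \in O).
Proof.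
by rewrite restr_ICA_Sym // => /setIP[_]; rewrite inE => /perm_closed.
Qed.

(** Converse of [coordinatesE]: coordinates are identified by testing [s] on the points
    [transport k x], which fill the box. *)
Lemma coordinates_unique s w : s \in ICA gT A -> w \in wreath n (restr_ICA O) ->
  (forall k x, x \in O ->
     s (transport k x) = transport (wreath_top w k) (wreath_base w k x)) ->
  coordinates s = w.
Proof.
move=> sC; rewrite inE => /forallP wC sE.
have top_eq : orbit_perm s = wreath_top w.
  apply/permP=> k; apply: enum_val_inj; rewrite -!/(box_orbit _) orbit_permE //.
  have:= box_orbit_in (wreath_top w k); rewrite inE => /andP[Qorb _].
  have:= box_orbit_in k; rewrite inE => /andP[Q'orb _].
  (* One test point suffices for the top component, since orbits sharing a point coincide. *)
  have /imsetP[x _ defO] := Oorb; have Ox : x \in O by rewrite defO orbit_refl.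
  rewrite (@orbits_eq _ (transport (wreath_top w k) (wreath_base w k x)) Qorb).
    by rewrite -sE // -ICA_orbit // (orbits_eq Q'orb (x := transport k x)) //
               -transO imset_f.
  by rewrite -transO imset_f ?restr_ICA_closed.
case: w wC sE top_eq => b p /= bC sE pE; rewrite -{}pE in sE *; congr Wreath.
apply/ffunP=> k; rewrite ffunE; apply/permP=> x.
have [Ox | nOx] := boolP (x \in O).
  apply: (@perm_inj _ (transport (orbit_perm s k))).
  by rewrite restr_permE ?mem_stab_perm ?base_cocycle_stab // !permM permKV sE.
rewrite (out_perm (restr_perm_on _ _)) //.
by have:= bC k; rewrite restr_ICA_Sym // => /setIP[_]; rewrite inE => /out_perm->.
Qed.

Lemma coordinates_inj_box s t x : s \in ICA gT A -> t \in ICA gT A ->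
  coordinates s = coordinates t -> x \in box A K -> s x = t x.
Proof.
move=> sC tC eq_st /orbit_box_orbits/box_orbit_surj[k defk].
have : x \in box_orbit k by rewrite -defk orbit_refl.
by rewrite -transO => /imsetP[y Oy ->]; rewrite !coordinatesE // eq_st.
Qed.

(** * Realising a prescribed wreath element *)

Section Realise.

Variable w : wreath_type {perm config gT A} n.
Hypothesis wC : w \in wreath n (restr_ICA O).

Let base_restr k : wreath_base w k \in restr_ICA O.
Proof. by move: wC; rewrite inE => /forallP/(_ k). Qed.

(** The value forced by [coordinatesE] on the box, extended by the identity elsewhere. *)
Definition realise_fun x : config gT A :=
  if [pick k | x \in box_orbit k] is Some k
  then transport (wreath_top w k) (wreath_base w k ((transport k)^-1 x))
  else x.

Let transport_in k x : (transport k x \in box_orbit k) = (x \in O).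
Proof. by rewrite -transO mem_imset //; apply: perm_inj. Qed.

Let realiseE k x : x \in O ->
  realise_fun (transport k x) = transport (wreath_top w k) (wreath_base w k x).
Proof.
move=> Ox; rewrite /realise_fun; case: pickP => [l xl | /(_ k)].
  by rewrite -(@box_orbit_inj k l _ _ xl) ?transport_in // permK.
by rewrite transport_in Ox.
Qed.

Let realise_out x : (forall k, x \notin box_orbit k) -> realise_fun x = x.
Proof.
by move=> xn; rewrite /realise_fun; case: pickP => // k; rewrite (negPf (xn k)).
Qed.

Let realise_case (P : config gT A -> Prop) :
    (forall k x, x \in O -> P (transport k x)) ->
    (forall x, (forall k, x \notin box_orbit k) -> P x) ->
  forall x, P x.
Proof.
move=> Pin Pout x; case: (pickP (fun k => x \in box_orbit k)) => [k | xn].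
  by rewrite -transO => /imsetP[y Oy ->]; apply: Pin.
by apply: Pout => k; rewrite xn.
Qed.

Lemma coordinates_surj : exists2 s, s \in ICA gT A & coordinates s = w.
Proof.
have realise_in k x : x \in O ->
    realise_fun (transport k x) \in box_orbit (wreath_top w k).
  by move=> Ox; rewrite realiseE // transport_in restr_ICA_closed ?base_restr.
(* The orbit of the image determines [k] through the top permutation, and then the transport and the
   base entry are undone. Points inside and outside the box cannot collide, as each part is mapped
   into itself. *)
have f_inj : injective realise_fun.
  elim/realise_case=> [k x Ox | x xn]; elim/realise_case=> [l y Oy | y yn].
  - move=> eq_f; have:= realise_in l y Oy; rewrite -eq_f.
    move/(box_orbit_inj (realise_in k x Ox))/perm_inj=> eq_kl.
    by move: eq_f; rewrite !realiseE // eq_kl => /perm_inj/perm_inj->.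
  - move=> eq_f; have:= yn (wreath_top w k).
    by rewrite -(realise_out yn) -eq_f realise_in.
  - move=> eq_f; have:= xn (wreath_top w l).
    by rewrite -(realise_out xn) eq_f realise_in.
  by rewrite !realise_out.
have sC : perm f_inj \in ICA gT A.
  apply/ICAP=> x g; rewrite !permE.
  elim/realise_case: x => [k x Ox | x xn].
    have /setIP[/ICAP bC _] : wreath_base w k \in ICA gT A :&: Sym O.
      by rewrite -restr_ICA_Sym.
    rewrite -(ICAP _ (transC k)) !realiseE ?orbits_shift // bC.
    exact/ICAP.
  rewrite !realise_out // => k.
  by have:= box_orbit_in k; rewrite inE => /andP[Qorb _]; rewrite orbits_shift.
exists (perm f_inj) => //; apply: coordinates_unique => // k x Ox.
by rewrite permE realiseE.
Qed.

End Realise.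

End Coordinates.

(** * Gluing over the boxes *)

Lemma box_conj (K L : {set gT}) x : x \in box A K -> x \in box A L ->
  K :^: [set: gT] = L :^: [set: gT].
Proof.
rewrite !inE => /imsetP[g _ stab_g] /imsetP[h _ stab_h].
suff conj_sub (B C : {set gT}) a b : B :^ a = C :^ b ->
    B :^: [set: gT] \subset C :^: [set: gT].
  apply/eqP; rewrite eqEsubset (conj_sub _ _ g h) ?(conj_sub _ _ h g) //.
    by rewrite -stab_h.
  by rewrite -stab_g.
move=> eqBC; apply/subsetP=> _ /imsetP[k _ ->].
by rewrite -[B](conjsgK a) eqBC -!conjsgM imset_f.
Qed.

(** Shifts and all the [s i] preserve each box, so the map that agrees with [s i] on the [i]-th box
    is still equivariant and injective. *)
Lemma ICA_glue (I : finType) (P : I -> {set gT}) (s : I -> {perm config gT A}) :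
    (forall x, exists i, x \in box A (P i)) ->
    (forall i j x, x \in box A (P i) -> x \in box A (P j) -> i = j) ->
    (forall i, s i \in ICA gT A) ->
  exists2 t, t \in ICA gT A & forall i x, x \in box A (P i) -> t x = s i x.
Proof.
move=> coverP uniqP sC; pose t x := s (xchoose (coverP x)) x.
have tE i x : x \in box A (P i) -> t x = s i x.
  by move=> xi; rewrite /t -(uniqP i _ x xi (xchooseP (coverP x))).
have t_inj : injective t.
  move=> x y eq_t; have [i xi] := coverP x; have [j yj] := coverP y.
  have := eq_t; rewrite (tE i) // (tE j) // => eq_s.
  have eq_ij : i = j.
    by apply: (uniqP i j (s i x)); [|rewrite eq_s]; rewrite ICA_box.
  by move: eq_s; rewrite eq_ij => /perm_inj.
exists (perm t_inj) => [|i x xi]; last by rewrite permE (tE i).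
apply/ICAP=> x g; have [i xi] := coverP x.
by rewrite !permE !(tE i) ?box_shift // (ICAP _ (sC i)).
Qed.

End InvertibleCA.

Theorem theorem2 (gT : finGroupType) (A : finType) (hA : (2 <= #|A|)%N)
  (r : nat) (H : 'I_r -> {group gT})
  (H_distinct : forall i j : 'I_r,
     H i :^: [set: gT] = H j :^: [set: gT] -> i = j)
  (H_all : forall K : {group gT},
     exists i : 'I_r, K :^: [set: gT] = H i :^: [set: gT])
  (O : 'I_r -> {set config gT A})
  (O_orbit : forall i : 'I_r, O i \in orbits gT A)
  (O_box : forall i : 'I_r, O i \subset box A (H i)) :
  (ICA gT A \isog
     setXn (fun i : 'I_r => wreath (alpha A (H i)) (restr_ICA (O i))))
  /\ (forall i : 'I_r,
        restr_ICA (O i) \isog 'C_(Sym (O i))(induced_group (O i))).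
Proof.
split=> [|i]; last by rewrite restr_ICA_centraliser // isog_refl.
have OH i : O i \in box_orbits A (H i) by rewrite inE O_orbit O_box.
have coverH x : exists i, x \in box A (H i).
  have [i stab_i] := H_all 'C[x | shift_action gT A]%G.
  by exists i; rewrite inE -stab_i; apply/imsetP; exists 1; rewrite ?conjsg1 ?inE.
have uniqH i j x : x \in box A (H i) -> x \in box A (H j) -> i = j.
  by move=> xi xj; apply: H_distinct; apply: box_conj xi xj.
(* The isomorphism collects the coordinates of [s] over all boxes. *)
pose f s : {dffun forall i, wreath_type {perm config gT A} (alpha A (H i))} :=
  [ffun i => coordinates (H i) (O i) s].
have fM : {in ICA gT A &, {morph f : s t / s * t}}.
  by move=> s t sC tC; apply/ffunP=> i; rewrite !ffunE coordinatesM.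
apply/isogP; exists (Morphism fM) => /=.
  apply/injmP=> s t sC tC /ffunP eq_f; apply/permP=> x.
  have [i xi] := coverH x.
  by apply: (coordinates_inj_box (OH i)) (xi) => //; have:= eq_f i; rewrite !ffunE.
rewrite morphimEdom; apply/setP=> w; apply/imsetP/setXnP => [[s sC -> i] | wC].
  by rewrite ffunE coordinates_wreath.
(* Surjectivity: each component is realised on its own box, and the realisations are glued. *)
have /fin_all_exists2[s sC sE] i := coordinates_surj (OH i) (wC i).
have [t tC tE] := ICA_glue coverH uniqH sC.
exists t => //; apply/ffunP=> i; rewrite ffunE.
(* [t] and [s i] agree only on the [i]-th box, which is enough because uniqueness tests only points
   [transport k x] of that box. *)
symmetry; apply: coordinates_unique (wC i) _ => // k x Ox.
rewrite (tE i) -?sE ?coordinatesE //.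
have [transC _] := transportP (OH i) k.
by rewrite ICA_box // (box_orbitsP (OH i)).
Qed.
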